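(* Let $m\ge 1$, $d\ge 3$, and let $x$ be a random vector in $\mathbb{R}^m$ with finite moments up to order $d$, with $d$-th order cumulant tensor $\mathcal{C}=\mathcal{C}^{x}_d\in\mathbb{R}^{m\times m\times\cdots\times m}$. For $1\le i_3,\dots,i_d\le m$ let $\mathcal{C}_{:,:,i_3,\dots,i_d}\in\mathbb{R}^{m\times m}$ be the matrix slice with $(i_1,i_2)$ entry $\mathcal{C}_{i_1i_2i_3\cdots i_d}$. If $n\ge m^{d-1}$, then there exist $P\in\mathrm{St}(m,n)$ and diagonal matrices $D_{i_3,\dots,i_d}\in\mathbb{R}^{n\times n}$ such that $$\mathcal{C}_{:,:,i_3,\dots,i_d}=P^{\mathsf T}D_{i_3,\dots,i_d}P\qquad\text{for all } 1\le i_3,\dots,i_d\le m.$$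
   Context: $\mathrm{St}(m,n)=\{P\in\mathbb{R}^{n\times m}:P^{\mathsf T}P=I_m\}$ for $n\ge m$. The $d$-th order cumulant tensor of $x=(x_1,\dots,x_m)$ is the symmetric tensor whose $(i_1,\dots,i_d)$ entry is the joint cumulant of $x_{i_1},\dots,x_{i_d}$, namely $\sum_{\pi}(-1)^{|\pi|-1}(|\pi|-1)!\prod_{\beta\in\pi}\mathbb{E}\big[\prod_{j\in\beta}x_{i_j}\big]$, the sum being over all partitions $\pi$ of $\{1,\dots,d\}$. *)

(* Defs.v *)
From HB Require Import structures.
From mathcomp Require Import all_boot all_order all_algebra.
From mathcomp Require Import all_classical all_reals all_analysis.

Set Implicit Arguments.
Unset Strict Implicit.
Unset Printing Implicit Defensive.

Import Order.TTheory GRing.Theory Num.Theory.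
Import numFieldNormedType.Exports.

Local Open Scope classical_set_scope.
Local Open Scope ring_scope.

(* Since P^T P = I_m forces m <= n, St(m,n) is empty when n < m. *)
Definition stiefel (R : realType) (m n : nat) : set 'M[R]_(n, m) :=
  [set Q | Q^T *m Q = 1%:M].
Arguments stiefel R m n : clear implicits.

(* A random vector in R^m is a measurable map into m.-tuple R, which carries
   the product sigma-algebra. *)
Section cumulants.
Context (R : realType) (disp : measure_display) (Omega : measurableType disp).
Context (P : probability Omega R).

Definition finite_moments (m d : nat) (X : {RV P >-> m.-tuple R}) : Prop :=
  forall (k : nat) (i : 'I_k -> 'I_m), (k <= d)%N ->
    P.-integrable [set: Omega]
      (fun w => (\prod_(j < k) tnth (X w) (i j))%:E).

(* [fine] reads off the real value of an expectation; it is faithful when the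
   moments of order at most d exist, and sends +oo and -oo to 0 otherwise. *)
Definition joint_cumulant (d : nat) (Y : 'I_d -> Omega -> R) : R :=
  \sum_(pi : {set {set 'I_d}} | finset.partition pi [set: 'I_d]%SET)
    (-1) ^+ (#|pi|.-1) * (#|pi|.-1)`!%:R *
    \prod_(B in pi) fine 'E_P[fun w => (\prod_(j in B) Y j w)%R].

Definition cumulant_tensor (m d : nat) (X : {RV P >-> m.-tuple R})
    (i : 'I_d -> 'I_m) : R :=
  joint_cumulant (fun k w => tnth (X w) (i k)).

End cumulants.

(* Given i3, ..., id (the tuple s), the matrix with (i1, i2) entry
   C (i1, i2, i3, ..., id). For 2 <= d the list i1 :: i2 :: s has length d, so
   the default value of nth is never used. *)
Definition tensor_slice (R : realType) (m d : nat) (C : ('I_d -> 'I_m) -> R)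
    (s : (d - 2).-tuple 'I_m) : 'M[R]_m :=
  \matrix_(i1 < m, i2 < m) C (fun k => nth i1 [:: i1, i2 & s] k).

(* Main.v *)
Require Import Defs.
From HB Require Import structures.
From mathcomp Require Import all_boot all_order all_algebra.
From mathcomp Require Import all_classical all_reals all_analysis.
From mathcomp Require Import perm complex ring.

Set Implicit Arguments.
Unset Strict Implicit.
Unset Printing Implicit Defensive.

Import Order.TTheory GRing.Theory Num.Theory.
Import numFieldNormedType.Exports.

Local Open Scope classical_set_scope.
Local Open Scope ring_scope.

(** A single spectral decomposition already solves the problem for one
    symmetric matrix: if A = U^T Lambda U with U orthogonal, take Q = U.  For
    finitely many symmetric matrices A_1, ..., A_N of size m, which need not
    commute, one buys room by stacking: let Q be N^(-1/2) times the N m x m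
    matrix with blocks U_1, ..., U_N, where A_k = U_k^T Lambda_k U_k.  Each
    block contributes U_k^T U_k / N = I / N to Q^T Q, so Q^T Q = I, and the
    diagonal matrix D_k that is N Lambda_k in the k-th block and 0 elsewhere
    satisfies Q^T D_k Q = A_k.  Rows of zeros fill up Q when n > N m.

    A tensor of order d has N = m^(d-2) slices, hence the bound
    N m = m^(d-1).  The slices are symmetric because a joint cumulant is
    invariant under permutations of its arguments (a permutation of the
    indices permutes the set partitions over which it is a sum).

    The remaining ingredient is the spectral theorem over a real closed field.
    A real eigenvalue comes from the diagonalisation of Hermitian matrices
    over the complex extension R[i]; a Householder reflection whose first row
    is a unit eigenvector then splits off one coordinate, and induction on the
    size finishes. *)

(** * The spectral theorem for real symmetric matrices *)

(** Over R[i] the matrix becomes Hermitian, so its eigenvalues are real; being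
    roots of a characteristic polynomial with coefficients in R, they are
    eigenvalues over R too. *)
Lemma symmetric_eigenvalue (R : rcfType) (n : nat) (A : 'M[R]_n.+1) :
  A^T = A -> exists a, eigenvalue A a.
Proof.
move=> Asym; pose B := map_mx (real_complex R) A.
have Breal : B \is a mxOver Num.real.
  by apply/mxOverP => i j; rewrite mxE complex_real.
have Bherm : B \is hermsymmx.
  apply: realsym_hermsym Breal; apply/is_hermitianmxP.
  by rewrite expr0 scale1r map_mx_id // map_trmx Asym.
have /mxOverP/(_ 0 0)/complex_realP[a aE] := hermitian_spectral_diag_real Bherm.
have /orthomx_spectralP Beq := hermitian_normalmx Bherm.
exists a; rewrite eigenvalue_root_char -(fmorph_root (real_complex R)).
rewrite map_char_poly -eigenvalue_root_char -/B.
apply/eigenvalueP; exists (row 0 (spectralmx B)); last first.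
  apply: contraTneq (spectral_unit B) => row0; rewrite unitmxE.
  rewrite (expand_det_row _ 0) big1 ?unitr0 // => j _.
  by have /rowP/(_ j) := row0; rewrite !mxE => ->; rewrite mul0r.
rewrite -row_mul [X in _ *m X]Beq !mulmxA mulmxV ?spectral_unit //.
by rewrite mul1mx row_mul row_diag_mx -scalemxAl -rowE aE.
Qed.

Lemma row_mul_tr_gt0 (R : realDomainType) (n : nat) (v : 'rV[R]_n) :
  v != 0 -> 0 < (v *m v^T) 0 0.
Proof.
move=> v0; rewrite mxE lt0r sumr_ge0 ?andbT => [|j _]; last first.
  by rewrite mxE -expr2 sqr_ge0.
apply: contraNneq v0; under eq_bigr do rewrite [in X in _ * X]mxE -expr2.
move=> /psumr_eq0P vi0; apply/eqP/rowP => j; rewrite [RHS]mxE; apply/eqP.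
by rewrite -sqrf_eq0 vi0 // => i _; apply: sqr_ge0.
Qed.

(** The Householder reflection in the hyperplane orthogonal to w = u - e_0
    exchanges the unit vectors e_0 and u, so its first row is u. *)
Lemma orthogonal_with_first_row (R : realFieldType) (n : nat)
    (u : 'rV[R]_n.+1) :
  u *m u^T = 1%:M -> exists2 H : 'M[R]_n.+1, H *m H^T = 1%:M & row 0 H = u.
Proof.
move=> uu; pose e : 'rV[R]_n.+1 := delta_mx 0 0.
pose w := u - e; pose t := (w *m w^T) 0 0.
have wwE : w *m w^T = t%:M by rewrite [LHS]mx11_scalar.
have ewE : e *m w^T = (u 0 0 - 1)%:M.
  by rewrite [LHS]mx11_scalar -rowE !mxE eqxx.
have tE : t = 2 * (1 - u 0 0).
  suff: w *m w^T = (2 * (1 - u 0 0))%:M by rewrite /t => ->; rewrite mxE.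
  rewrite {1}/w mulmxBl ewE linearB /= mulmxBr uu trmx_delta -colE.
  rewrite [col 0 u]mx11_scalar -!raddfB /= !mxE; congr (_%:M); ring.
have [w0|/row_mul_tr_gt0 t_gt0] := eqVneq w 0.
  exists 1%:M; first by rewrite trmx1 mulmx1.
  by move/eqP: w0; rewrite subr_eq0 => /eqP ->; rewrite row1.
have t0 : t != 0 by rewrite gt_eqF.
pose H := 1%:M - (2 / t) *: (w^T *m w).
have Hsym : H^T = H by rewrite /H linearB linearZ /= trmx1 trmx_mul trmxK.
exists H.
  rewrite Hsym /H mulmxBr mulmx1 mulmxBl mul1mx -scalemxAl -scalemxAr.
  rewrite -mulmxA (mulmxA w) wwE mul_scalar_mx -scalemxAr !scalerA.
  rewrite (_ : 2 / t * (2 / t * t) = 2 / t + 2 / t); last by field.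
  by rewrite scalerDl opprB addrK subrK.
rewrite rowE -/e mulmxBr mulmx1 -scalemxAr mulmxA ewE mul_scalar_mx scalerA.
rewrite (_ : 2 / t * (u 0 0 - 1) = -1).
  by rewrite scaleN1r opprK addrC subrK.
apply: (mulIf t0); rewrite mulrAC divfK // tE; ring.
Qed.

(** Conjugating A by an orthogonal matrix whose first row is a unit eigenvector
    u makes the first row of the result a multiple of e_0; by symmetry its
    first column is one too, so a smaller symmetric block remains. *)
Lemma real_spectral (R : rcfType) (n : nat) (A : 'M[R]_n) : A^T = A ->
  exists (U : 'M[R]_n) (l : 'rV[R]_n),
    U^T *m U = 1%:M /\ A = U^T *m diag_mx l *m U.
Proof.
elim: n A => [|n IHn] A Asym.
  by exists 1%:M, 0; rewrite !flatmx0; split; apply/matrixP => -[].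
have [a /eigenvalueP[v vA v0]] := symmetric_eigenvalue Asym.
pose s := Num.sqrt ((v *m v^T) 0 0).
have vv_gt0 : 0 < (v *m v^T) 0 0 := row_mul_tr_gt0 v0.
have s_gt0 : 0 < s by rewrite sqrtr_gt0.
pose u := s^-1 *: v.
have uA : u *m A = a *: u by rewrite -scalemxAl vA !scalerA mulrC.
have uu : u *m u^T = 1%:M.
  rewrite linearZ -scalemxAl -scalemxAr [v *m _]mx11_scalar scalerA.
  rewrite scale_scalar_mx -invfM -expr2 sqr_sqrtr ?ltW // mulVf ?gt_eqF //.
have [H HHt rowH] := orthogonal_with_first_row uu.
have HtH : H^T *m H = 1%:M by apply: mulmx1C.
pose B : 'M[R]_(1 + n) := H *m A *m H^T.
have Bsym : B^T = B by rewrite /B !trmx_mul trmxK Asym mulmxA.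
have rowB : usubmx B = row_mx a%:M 0.
  have -> : usubmx B = row 0 B.
    by apply/rowP => j; rewrite [LHS]mxE [RHS]mxE; congr (B _ _); apply/val_inj.
  rewrite /B !row_mul rowH uA -rowH -scalemxAl -row_mul HHt row1.
  apply/rowP => j; rewrite !mxE eqxx /=; case: splitP => k; rewrite ?ord1 => jk.
    by rewrite !mxE -val_eqE /= jk mulr1.
  by rewrite !mxE -val_eqE /= jk mulr0.
pose C := drsubmx B.
have Csym : C^T = C by rewrite /C trmx_drsub Bsym.
have BE : B = block_mx a%:M 0 0 C.
  rewrite -[LHS](@submxK _ 1 n 1 n) /ulsubmx /ursubmx rowB row_mxKl row_mxKr.
  by congr block_mx; rewrite -[LHS]trmxK trmx_dlsub Bsym /ursubmx rowB
                             row_mxKr trmx0.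
have [V [l [VV CE]]] := IHn C Csym.
pose W : 'M[R]_(1 + n) := block_mx 1%:M 0 0 V.
have WT : W^T = block_mx 1%:M 0 0 V^T by rewrite tr_block_mx !trmx0 trmx1.
have WW : W^T *m W = 1%:M.
  rewrite WT mulmx_block !mulmx0 !mul0mx !mulmx1 !addr0 !add0r VV.
  by rewrite -scalar_mx_block.
have WBW : W^T *m diag_mx (row_mx a%:M l) *m W = B.
  rewrite WT diag_mx_row !mulmx_block !mulmx0 !mul0mx !mulmx1 !mul1mx.
  rewrite !addr0 !add0r BE -CE mul0mx; congr block_mx.
  by apply/matrixP => i j; rewrite !mxE !ord1.
exists (W *m H), (row_mx a%:M l).
split; first by rewrite trmx_mul mulmxA -(mulmxA H^T) WW mulmx1.
rewrite trmx_mul !mulmxA -(mulmxA H^T) -(mulmxA H^T) WBW.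
by rewrite /B !mulmxA HtH mul1mx -mulmxA HtH mulmx1.
Qed.

(** * Stacking orthonormal eigenbases *)

(** Q stacks one orthonormal eigenbasis per matrix, and the diagonal matrix of
    index s only sees the block of s.  Scaling the stack by 1 / sqrt N, with N
    the number of matrices, makes its columns orthonormal; the factor N in D
    undoes this scaling. *)
Lemma simultaneous_diag_stiefel (R : rcfType) (S : finType) (m n : nat)
    (A : S -> 'M[R]_m) :
  (0 < #|S|)%N -> (#|S| * m <= n)%N -> (forall s, (A s)^T = A s) ->
  exists (Q : 'M[R]_(n, m)) (D : S -> 'M[R]_n),
    [/\ Q^T *m Q = 1%:M, (forall s, is_diag_mx (D s)) &
        (forall s, A s = Q^T *m D s *m Q)].
Proof.
move=> S_gt0 Smn Asym.
pose N : R := #|S|%:R.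
have N0 : N != 0 by rewrite pnatr_eq0 -lt0n.
pose r := (Num.sqrt N)^-1.
have rr : r * r = N^-1 by rewrite -invfM -expr2 sqr_sqrtr ?ler0n.
have spec s : {Ul : 'M[R]_m * 'rV[R]_m | Ul.1^T *m Ul.1 = 1%:M /\
    A s = Ul.1^T *m diag_mx Ul.2 *m Ul.1}.
  by apply: cid; have [U [l UA]] := real_spectral (Asym s); exists (U, l).
pose U (k : 'I_#|S|) := (sval (spec (enum_val k))).1.
pose l s := (sval (spec s)).2.
have UU k : (U k)^T *m U k = 1%:M by case: (svalP (spec (enum_val k))).
have UA s : (U (enum_rank s))^T *m diag_mx (l s) *m U (enum_rank s) = A s.
  by rewrite /U enum_rankK; case: (svalP (spec s)).
pose Q0 := r *: \mxcol_(k < #|S|) U k.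
have Q0T : Q0^T = r *: \mxrow_(k < #|S|) (U k)^T.
  by rewrite /Q0 linearZ /= tr_mxcol.
pose L s k := if k == enum_rank s then N *: l s else 0.
pose d0 s := \mxrow_(k < #|S|) L s k.
have Q0Q0 : Q0^T *m Q0 = 1%:M.
  rewrite Q0T -scalemxAl -scalemxAr scalerA rr.
  rewrite mul_mxrow_mxcol (eq_bigr _ (fun k _ => UU k)) sumr_const card_ord.
  by rewrite -scaler_nat scalerA mulVf // scale1r.
have Q0A s : Q0^T *m diag_mx (d0 s) *m Q0 = A s.
  rewrite Q0T -!scalemxAl -scalemxAr scalerA rr.
  rewrite diag_mxrow -mulmxA mul_mxdiag_mxcol mul_mxrow_mxcol.
  rewrite (bigD1 (enum_rank s)) //= big1 => [|k /negPf ks]; last first.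
    by rewrite /L ks linear0 mul0mx mulmx0.
  rewrite addr0 /L eqxx linearZ /= -scalemxAl -scalemxAr scalerA mulVf //.
  by rewrite scale1r mulmxA UA.
have [k nE] : exists k, n = (\sum_(k < #|S|) m + k)%N.
  by exists (n - #|S| * m)%N; rewrite sum_nat_const card_ord subnKC.
rewrite nE; exists (col_mx Q0 0), (fun s => diag_mx (row_mx (d0 s) 0)).
split=> [|s|s]; first by rewrite tr_col_mx mul_row_col trmx0 mulmx0 addr0.
- exact: diag_mx_is_diag.
- rewrite diag_mx_row tr_col_mx mul_row_block mul_row_col !mulmx0 !addr0.
  by rewrite Q0A.
Qed.

(** * Symmetry of cumulants *)

(** A permutation of the indices maps set partitions bijectively to set
    partitions with the same number of blocks, and merely reindexes the
    product of variables inside each block. *)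
Lemma joint_cumulant_perm (R : realType) (disp : measure_display)
    (Omega : measurableType disp) (P : probability Omega R) (d : nat)
    (Y : 'I_d -> Omega -> R) (sigma : {perm 'I_d}) :
  joint_cumulant P (fun k => Y (sigma k)) = joint_cumulant P Y.
Proof.
pose im (pi : {set {set 'I_d}}) :=
  [set sigma @: (B : {set 'I_d}) | B in pi]%SET.
have im_inj : injective im.
  by apply: imset_inj; apply: imset_inj; apply: perm_inj.
rewrite /joint_cumulant [RHS](reindex_inj im_inj) /=.
have fullE : (sigma @: [set: 'I_d] = [set: 'I_d])%SET.
  apply/setP => i; rewrite !inE; apply/imsetP.
  by exists ((sigma^-1)%g i); rewrite ?inE ?permKV.
apply: eq_big => [pi|pi _].
  by rewrite -(imset_partition _ _ (@perm_inj _ sigma)) fullE.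
have cim : #|im pi| = #|pi| by rewrite card_imset //; apply/imset_inj/perm_inj.
rewrite cim; congr (_ * _).
rewrite big_imset => [|B C _ _ /imset_inj]; last by apply; apply: perm_inj.
apply: eq_bigr => B _; congr (fine ('E_P[_])); apply/funext => w.
by rewrite big_imset // => i j _ _ /perm_inj.
Qed.

Lemma cumulant_tensor_perm (R : realType) (disp : measure_display)
    (Omega : measurableType disp) (P : probability Omega R) (m d : nat)
    (X : {RV P >-> m.-tuple R}) (i : 'I_d -> 'I_m) (sigma : {perm 'I_d}) :
  cumulant_tensor X (fun k => i (sigma k)) = cumulant_tensor X i.
Proof. exact: (joint_cumulant_perm _ (fun k w => tnth (X w) (i k))). Qed.

(** Transposing a slice exchanges the first two indices of the tensor. *)
Lemma tensor_slice_sym (R : realType) (m d : nat) (C : ('I_d -> 'I_m) -> R)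
    (s : (d - 2).-tuple 'I_m) :
  (2 <= d)%N ->
  (forall i (sigma : {perm 'I_d}), C (fun k => i (sigma k)) = C i) ->
  (tensor_slice C s)^T = tensor_slice C s.
Proof.
move=> d2 Csym; apply/matrixP => a b; rewrite !mxE.
pose i0 := Ordinal (ltnW d2); pose i1 := Ordinal d2.
rewrite -[RHS](Csym _ (tperm i0 i1)); congr C; apply/funext => k.
have szs : (size s).+2 = d by rewrite size_tuple -addn2 subnK.
(* Both defaults of nth are out of reach; aligning them leaves only the
   comparison of entries. *)
rewrite (set_nth_default a) /=; last by rewrite szs.
case: tpermP => [->|->|/eqP k0 /eqP k1] //.
by case: k k0 k1 => [[|[|k]] kd].
Qed.

(** * Simultaneous diagonalisation of the cumulant slices *)

Theorem theorem8p2 (R : realType) (disp : measure_display)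
    (Omega : measurableType disp) (P : probability Omega R)
    (m d n : nat) (X : {RV P >-> m.-tuple R})
    (m_ge1 : (1 <= m)%N) (d_ge3 : (3 <= d)%N)
    (X_moments : finite_moments d X)
    (n_ge : (m ^ (d - 1) <= n)%N) :
  exists (Q : 'M[R]_(n, m)) (D : (d - 2).-tuple 'I_m -> 'M[R]_n),
    [/\ Q \in stiefel R m n,
        (forall s, is_diag_mx (D s)) &
        (forall s, tensor_slice (cumulant_tensor (d := d) X) s
                   = Q^T *m D s *m Q)].
Proof.
pose A s := tensor_slice (cumulant_tensor (d := d) X) s.
have d_ge2 : (2 <= d)%N := ltnW d_ge3.
have cardS : #|{: (d - 2).-tuple 'I_m}| = (m ^ (d - 2))%N.
  by rewrite card_tuple card_ord.
have [||s|Q [D [QQ Ddiag AQ]]] := @simultaneous_diag_stiefel R _ m n A.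
- by rewrite cardS expn_gt0 m_ge1.
- by rewrite cardS -expnSr -subSn // subSS.
- exact: tensor_slice_sym d_ge2 (cumulant_tensor_perm X).
by exists Q, D; split=> //; rewrite inE.
Qed.
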